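(* Let $\mathbf a:\mathbb R^D\to\mathcal H$ define a dictionary $\mathcal A=\{\mathbf a(\theta):\theta\in\mathbb R^D\}$ in a real Hilbert space $\mathcal H$ whose kernel $\kappa$ is admissible, and let $\mathcal S^\star=\{\theta^\star_\ell\}_{\ell=1}^k\subset\mathbb R^D$ (pairwise distinct) be admissible with respect to $\kappa$. Then for every subset $\mathcal S\subseteq\mathcal S^\star$, OMP achieves exact $\mathrm{card}(\mathcal S)$-step recovery of $\mathcal S$.
   Context: Kernel: $\kappa(\theta,\theta')=\langle\mathbf a(\theta),\mathbf a(\theta')\rangle$. The kernel is admissible if: (i) $\kappa(\theta,\theta)=1$ for all $\theta$; $\lim_{\theta'\to\theta}\kappa(\theta,\theta')=1$ for all $\theta$; for every $\varepsilon>0$ and $\theta$ there is a compact $K$ with $\sup_{\theta'\notin K}\kappa(\theta',\theta)<\varepsilon$; (ii) $0\le\kappa(\theta,\theta')<1$ whenever $\theta\ne\theta'$. A support $\mathcal S^\star=\{\theta^\star_\ell\}_{\ell=1}^k$ is admissible with respect to $\kappa$ if for every nonempty $T\subseteq\{1,\dots,k\}$ and every positive reals $\{c_\ell\}_{\ell\in T}$ with $\sum_{\ell\in T}c_\ell<1$, setting $\psi(\theta)=\sum_{\ell\in T}c_\ell\kappa(\theta,\theta^\star_\ell)$: (i) the set of global maximizers of $\psi$ over $\mathbb R^D$ is contained in $\{\theta^\star_\ell\}_{\ell\in T}$; (ii) if $\ell\in\{1,\dots,k\}\setminus T$ satisfies $\psi(\theta)-\kappa(\theta,\theta^\star_\ell)\le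 0$ for all $\theta\in\{\theta^\star_{\ell'}\}_{\ell'\in T}$, then $\psi(\theta)-\kappa(\theta,\theta^\star_\ell)\le0$ for all $\theta\in\mathbb R^D$. OMP with input $\mathbf y\in\mathcal H$: set $\mathbf r=\mathbf y$, $\widehat{\mathcal S}=\emptyset$, $t=0$; while $\mathbf r\ne 0$: $t\leftarrow t+1$; choose any $\widehat\theta_t\in\arg\max_{\theta}|\langle\mathbf a(\theta),\mathbf r\rangle|$; $\widehat{\mathcal S}\leftarrow\widehat{\mathcal S}\cup\{\widehat\theta_t\}$; compute $(\widehat c_1,\dots,\widehat c_t)\in\arg\min_{c\in\mathbb R^t}\|\mathbf y-\sum_{\ell=1}^t c_\ell\mathbf a(\widehat\theta_\ell)\|$; set $\mathbf r=\mathbf y-\sum_{\ell=1}^t\widehat c_\ell\mathbf a(\widehat\theta_\ell)$. Output $\widehat{\mathcal S}$. A reachable support is any output $\widehat{\mathcal S}$ obtainable through some sequence of choices of maximizers. For a finite set $\mathcal S^\star=\{\theta^\star_\ell\}_{\ell=1}^k$ of pairwise distinct parameters, OMP achieves exact $k$-step recovery of $\mathcal S^\star$ if for every choice of nonzero reals $c_1,\dots,c_k$ every reachable support of OMP with input $\mathbf y=\sum_{\ell=1}^k c_\ell\mathbf a(\theta^\star_\ell)$ equals $\mathcal S^\star$ (for $\mathcal S^\star=\emptyset$ this holds trivially). *)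

(* Defs.v *)
From Stdlib Require Fin.
From Stdlib Require Import Reals List.
Import ListNotations.
Open Scope R_scope.

Record RealHilbert := {
  hcarrier :> Type;
  vzero : hcarrier;
  vadd : hcarrier -> hcarrier -> hcarrier;
  vopp : hcarrier -> hcarrier;
  vscal : R -> hcarrier -> hcarrier;
  inner : hcarrier -> hcarrier -> R;
  vadd_assoc : forall x y z, vadd x (vadd y z) = vadd (vadd x y) z;
  vadd_comm : forall x y, vadd x y = vadd y x;
  vadd_0l : forall x, vadd vzero x = x;
  vadd_oppr : forall x, vadd x (vopp x) = vzero;
  vscal_assoc : forall a b x, vscal a (vscal b x) = vscal (a * b) x;
  vscal_1 : forall x, vscal 1 x = x;
  vscal_distr_v : forall a x y, vscal a (vadd x y) = vadd (vscal a x) (vscal a y);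
  vscal_distr_s : forall a b x, vscal (a + b) x = vadd (vscal a x) (vscal b x);
  inner_sym : forall x y, inner x y = inner y x;
  inner_add_l : forall x y z, inner (vadd x y) z = inner x z + inner y z;
  inner_scal_l : forall a x y, inner (vscal a x) y = a * inner x y;
  inner_nonneg : forall x, 0 <= inner x x;
  inner_def : forall x, inner x x = 0 -> x = vzero;
  hcomplete : forall u : nat -> hcarrier,
    (forall eps, eps > 0 -> exists N, forall m n, (N <= m)%nat -> (N <= n)%nat ->
        sqrt (inner (vadd (u m) (vopp (u n))) (vadd (u m) (vopp (u n)))) < eps) ->
    exists l, forall eps, eps > 0 -> exists N, forall n, (N <= n)%nat ->
        sqrt (inner (vadd (u n) (vopp l)) (vadd (u n) (vopp l))) < eps
}.

Arguments vzero {_}. Arguments vadd {_}. Arguments vopp {_}.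
Arguments vscal {_}. Arguments inner {_}.

Definition vsub {H : RealHilbert} (x y : H) : H := vadd x (vopp y).
Definition hnorm {H : RealHilbert} (x : H) : R := sqrt (inner x x).

Fixpoint sumR (n : nat) (f : nat -> R) : R :=
  match n with O => 0 | S m => sumR m f + f m end.

Fixpoint vsum {H : RealHilbert} (n : nat) (f : nat -> H) : H :=
  match n with O => vzero | S m => vadd (vsum m f) (f m) end.

Definition Param (D : nat) := Fin.t D -> R.

(* Open sets and compact sets of R^D (topology of the sup-norm = Euclidean topology) *)
Definition is_open {D : nat} (U : Param D -> Prop) : Prop :=
  forall x, U x -> exists r, r > 0 /\
    forall y, (forall i, Rabs (y i - x i) < r) -> U y.

Definition is_compact {D : nat} (K : Param D -> Prop) : Prop :=
  forall (I : Type) (U : I -> Param D -> Prop),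
    (forall i, is_open (U i)) ->
    (forall x, K x -> exists i, U i x) ->
    exists l : list I, forall x, K x -> exists i, In i l /\ U i x.

Definition kappa {D : nat} {H : RealHilbert} (a : Param D -> H) (t t' : Param D) : R :=
  inner (a t) (a t').

Definition kernel_admissible {D : nat} {H : RealHilbert} (a : Param D -> H) : Prop :=
  (forall t, kappa a t t = 1) /\
  (forall t eps, eps > 0 -> exists delta, delta > 0 /\
     forall t', t' <> t -> (forall i, Rabs (t' i - t i) < delta) ->
       Rabs (kappa a t t' - 1) < eps) /\
  (* sup_{t' not in K} kappa(t', t) < eps *)
  (forall eps t, eps > 0 -> exists K : Param D -> Prop, is_compact K /\
     exists eta, eta < eps /\ forall t', ~ K t' -> kappa a t' t <= eta) /\
  (forall t t', t <> t' -> 0 <= kappa a t t' /\ kappa a t t' < 1).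

Definition is_global_max {D : nat} (f : Param D -> R) (x : Param D) : Prop :=
  forall y, f y <= f x.

(** Support S* = {th 0, ..., th (k-1)}; subsets T of {0..k-1} are boolean predicates. *)
Definition support_admissible {D : nat} {H : RealHilbert} (a : Param D -> H)
    (k : nat) (th : nat -> Param D) : Prop :=
  forall (T : nat -> bool) (c : nat -> R),
    (exists l, (l < k)%nat /\ T l = true) ->
    (forall l, (l < k)%nat -> T l = true -> c l > 0) ->
    sumR k (fun l => if T l then c l else 0) < 1 ->
    let psi := fun t => sumR k (fun l => if T l then c l * kappa a t (th l) else 0) in
    (forall t, is_global_max psi t -> exists l, (l < k)%nat /\ T l = true /\ t = th l) /\
    (forall l, (l < k)%nat -> T l = false ->
       (forall l', (l' < k)%nat -> T l' = true -> psi (th l') - kappa a (th l') (th l) <= 0) ->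
       forall t, psi t - kappa a t (th l) <= 0).

Fixpoint comb {D : nat} {H : RealHilbert} (a : Param D -> H)
    (ths : list (Param D)) (c : nat -> R) : H :=
  match ths with
  | [] => vzero
  | t :: rest => vadd (vscal (c O) (a t)) (comb a rest (fun n => c (S n)))
  end.

Definition lsq_residual {D : nat} {H : RealHilbert} (a : Param D -> H)
    (y : H) (ths : list (Param D)) (r : H) : Prop :=
  exists c : nat -> R,
    (forall c' : nat -> R, hnorm (vsub y (comb a ths c)) <= hnorm (vsub y (comb a ths c'))) /\
    r = vsub y (comb a ths c).

Inductive omp_run {D : nat} {H : RealHilbert} (a : Param D -> H) (y : H) :
    list (Param D) -> H -> Prop :=
  | omp_start : omp_run a y [] y
  | omp_step : forall ths r t r',
      omp_run a y ths r ->
      r <> vzero ->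
      (forall t', Rabs (inner (a t') r) <= Rabs (inner (a t) r)) ->
      lsq_residual a y (ths ++ [t]) r' ->
      omp_run a y (ths ++ [t]) r'.

Definition reachable_support {D : nat} {H : RealHilbert} (a : Param D -> H)
    (y : H) (S : Param D -> Prop) : Prop :=
  exists ths, omp_run a y ths vzero /\ forall t, S t <-> In t ths.

Definition exact_recovery {D : nat} {H : RealHilbert} (a : Param D -> H)
    (k : nat) (th : nat -> Param D) (T : nat -> bool) : Prop :=
  forall c : nat -> R,
    (forall l, (l < k)%nat -> T l = true -> c l <> 0) ->
    let y := vsum k (fun l => if T l then vscal (c l) (a (th l)) else vzero) in
    forall S, reachable_support a y S ->
      forall t, S t <-> exists l, (l < k)%nat /\ T l = true /\ t = th l.

(* Main.v *)
(** Every span element [f = sum_l c_l kappa(., theta_l)] over a subset [T] of the support takes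
    at every point outside [T] a value whose modulus is smaller than its largest modulus on [T].
    This is proved by induction on the size of [T], together with the fact that the interpolant
    on [T] of a kernel [kappa(., theta_n)], [n] not in [T], stays below this kernel.  Indeed,
    let [P] collect the indices with [c_l > 0].  If [P = T], admissibility (i) concludes.
    Otherwise each kernel with a nonpositive coefficient is replaced by its interpolant on [P]:
    this keeps the values on [P], can only increase [f], and leaves a span element over the
    smaller set [P].  The same replacement shows that the coefficients of the interpolant of
    [kappa(., theta_n)] are nonnegative; their sum is the value at [theta_n] of the interpolant
    of the constant [1], hence is less than [1], and admissibility (ii) applies.

    Consequently OMP only ever selects points of the support, and since the atoms of the support
    are linearly independent, the residual can vanish only once all of them are selected. *)

Require Import Defs.
From Stdlib Require Import Reals List.
From Stdlib Require Import Classical Lia Lra PeanoNat Bool Wf_nat.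
Import ListNotations.
Open Scope R_scope.

(** * Finite sums *)

Lemma sumR_ext n f g : (forall l, (l < n)%nat -> f l = g l) -> sumR n f = sumR n g.
Proof.
  induction n as [|n IH]; intros Hfg; [reflexivity|].
  simpl. rewrite IH by (intros; apply Hfg; lia). now rewrite Hfg by lia.
Qed.

Lemma sumR_le n f g : (forall l, (l < n)%nat -> f l <= g l) -> sumR n f <= sumR n g.
Proof.
  induction n as [|n IH]; intros Hfg; simpl; [lra|].
  assert (sumR n f <= sumR n g) by (apply IH; intros; apply Hfg; lia).
  assert (f n <= g n) by (apply Hfg; lia). lra.
Qed.

Lemma sumR_plus n f g : sumR n (fun l => f l + g l) = sumR n f + sumR n g.
Proof. induction n as [|n IH]; simpl; [|rewrite IH]; ring. Qed.

Lemma sumR_scal n x f : sumR n (fun l => x * f l) = x * sumR n f.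
Proof. induction n as [|n IH]; simpl; [|rewrite IH]; ring. Qed.

Lemma sumR_0 n f : (forall l, (l < n)%nat -> f l = 0) -> sumR n f = 0.
Proof.
  intros Hf. rewrite (sumR_ext _ _ (fun l => 0 * f l)), sumR_scal; [ring|].
  intros l Hl. rewrite Hf by exact Hl. ring.
Qed.

Lemma sumR_nonneg n f : (forall l, (l < n)%nat -> 0 <= f l) -> 0 <= sumR n f.
Proof.
  intros Hf. rewrite <- (sumR_0 n (fun _ => 0)) by reflexivity. now apply sumR_le.
Qed.

Lemma sumR_exchange m n (f : nat -> nat -> R) :
  sumR m (fun i => sumR n (f i)) = sumR n (fun j => sumR m (fun i => f i j)).
Proof.
  induction m as [|m IH]; simpl.
  - symmetry. now apply sumR_0.
  - now rewrite IH, sumR_plus.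
Qed.

Definition delta (j l : nat) : R := if Nat.eqb j l then 1 else 0.

Lemma delta_same j : delta j j = 1.
Proof. unfold delta. now rewrite Nat.eqb_refl. Qed.

Lemma delta_neq j l : j <> l -> delta j l = 0.
Proof. intros Hjl. unfold delta. now apply Nat.eqb_neq in Hjl as ->. Qed.

Lemma sumR_delta n j f : (j < n)%nat -> sumR n (fun l => delta j l * f l) = f j.
Proof.
  induction n as [|n IH]; intros Hj; [lia|]. simpl.
  destruct (Nat.eq_dec j n) as [->|Hjn].
  - rewrite delta_same, sumR_0; [ring|]. intros l Hl. rewrite delta_neq by lia. ring.
  - rewrite IH by lia. rewrite delta_neq by exact Hjn. ring.
Qed.

Lemma sumR_term_le n j f :
  (j < n)%nat -> (forall l, (l < n)%nat -> 0 <= f l) -> f j <= sumR n f.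
Proof.
  intros Hj Hf. rewrite <- (sumR_delta n j f) by exact Hj. apply sumR_le.
  intros l Hl. specialize (Hf l Hl). unfold delta. destruct (Nat.eqb j l); lra.
Qed.

Definition cardn (k : nat) (T : nat -> bool) : nat := length (filter T (seq 0 k)).

Lemma cardn_strict k (P T : nat -> bool) l :
  (forall l, (l < k)%nat -> P l = true -> T l = true) ->
  (l < k)%nat -> T l = true -> P l = false -> (cardn k P < cardn k T)%nat.
Proof.
  intros HPT Hl HT HP. unfold cardn.
  assert (Hsub : forall i, In i (seq 0 k) -> P i = true -> T i = true).
  { intros i Hi. apply HPT. apply in_seq in Hi. lia. }
  assert (Hin : In l (seq 0 k)) by (apply in_seq; lia).
  revert Hsub Hin. generalize (seq 0 k) as s.
  assert (Hle : forall s, (forall i, In i s -> P i = true -> T i = true) ->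
            (length (filter P s) <= length (filter T s))%nat).
  { induction s as [|i s IH]; intros Hs; [simpl; lia|].
    assert (IHs := IH (fun j Hj => Hs j (or_intror Hj))).
    specialize (Hs i (or_introl eq_refl)). simpl.
    destruct (P i); [rewrite Hs by reflexivity|destruct (T i)]; simpl; lia. }
  induction s as [|i s IH]; intros Hs Hin; [contradiction|].
  assert (Hs' := fun j Hj => Hs j (or_intror Hj)).
  destruct Hin as [->|Hin].
  - simpl. rewrite HP, HT. specialize (Hle s Hs'). simpl. lia.
  - specialize (IH Hs' Hin). specialize (Hs i (or_introl eq_refl)). simpl.
    destruct (P i); [rewrite Hs by reflexivity|destruct (T i)]; simpl; lia.
Qed.

(** * Inner products *)

Lemma inner_add_r (H : RealHilbert) (x y z : H) : inner x (vadd y z) = inner x y + inner x z.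
Proof. now rewrite inner_sym, inner_add_l, 2!(inner_sym H x). Qed.

Lemma inner_scal_r (H : RealHilbert) s (x y : H) : inner x (vscal s y) = s * inner x y.
Proof. now rewrite inner_sym, inner_scal_l, (inner_sym H x). Qed.

Lemma inner_zero_r (H : RealHilbert) (x : H) : inner x vzero = 0.
Proof.
  assert (E := inner_add_r H x vzero vzero). rewrite vadd_0l in E. lra.
Qed.

Lemma inner_sub_r (H : RealHilbert) (x y z : H) : inner x (vsub y z) = inner x y - inner x z.
Proof.
  assert (E := inner_add_r H x z (vopp z)). rewrite vadd_oppr, inner_zero_r in E.
  unfold vsub. rewrite inner_add_r. lra.
Qed.

Lemma inner_sub_l (H : RealHilbert) (x y z : H) : inner (vsub x y) z = inner x z - inner y z.
Proof. now rewrite inner_sym, inner_sub_r, 2!(inner_sym H z). Qed.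

(** Cauchy-Schwarz against a unit vector, by expanding the squared norm of [u] minus its projection
    on [w]. *)
Lemma inner_unit_sqr_le (H : RealHilbert) (u w : H) :
  inner w w = 1 -> inner u w * inner u w <= inner u u.
Proof.
  intros Hw. assert (Hn := inner_nonneg H (vsub u (vscal (inner u w) w))).
  rewrite inner_sub_r, !inner_sub_l, !inner_scal_r, !inner_scal_l in Hn.
  rewrite Hw, (inner_sym H w u) in Hn. nra.
Qed.

(** * Compactness and continuity *)

Lemma compact_empty D : @is_compact D (fun _ => False).
Proof. intros I U _ _. exists []. tauto. Qed.

Lemma compact_union D (K L : Param D -> Prop) :
  is_compact K -> is_compact L -> is_compact (fun x => K x \/ L x).
Proof.
  intros HK HL I U HU Hc.
  destruct (HK I U HU (fun x Hx => Hc x (or_introl Hx))) as [l1 H1].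
  destruct (HL I U HU (fun x Hx => Hc x (or_intror Hx))) as [l2 H2].
  exists (l1 ++ l2). intros x [Hx|Hx].
  - destruct (H1 x Hx) as [i [Hi Ux]]. exists i. split; [apply in_or_app; now left|exact Ux].
  - destruct (H2 x Hx) as [i [Hi Ux]]. exists i. split; [apply in_or_app; now right|exact Ux].
Qed.

Definition cont {D : nat} (f : Param D -> R) : Prop :=
  forall x eps, eps > 0 -> exists r, r > 0 /\
    forall y, (forall i, Rabs (y i - x i) < r) -> Rabs (f y - f x) < eps.

Lemma cont_scal D (f : Param D -> R) s : cont f -> cont (fun t => s * f t).
Proof.
  intros Hf x eps Heps. assert (Hs := Rabs_pos s).
  destruct (Hf x (eps / (Rabs s + 1))) as [r [Hr Hy]]; [apply Rdiv_lt_0_compat; lra|].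
  exists r. split; [exact Hr|]. intros y Hxy. specialize (Hy y Hxy).
  replace (s * f y - s * f x) with (s * (f y - f x)) by ring. rewrite Rabs_mult.
  apply (Rmult_lt_compat_l (Rabs s + 1)) in Hy; [|lra].
  replace ((Rabs s + 1) * (eps / (Rabs s + 1))) with eps in Hy by (field; lra).
  assert (Hn := Rabs_pos (f y - f x)). lra.
Qed.

Lemma cont_sumR D n (f : nat -> Param D -> R) :
  (forall l, (l < n)%nat -> cont (f l)) -> cont (fun t => sumR n (fun l => f l t)).
Proof.
  induction n as [|n IH]; intros Hf x eps Heps; simpl.
  - exists 1. split; [lra|]. intros. rewrite Rminus_diag, Rabs_R0. exact Heps.
  - destruct (IH (fun l Hl => Hf l (Nat.lt_lt_succ_r _ _ Hl)) x (eps / 2)) as [r1 [Hr1 H1]]; [lra|].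
    destruct (Hf n (Nat.lt_succ_diag_r n) x (eps / 2)) as [r2 [Hr2 H2]]; [lra|].
    exists (Rmin r1 r2). split; [now apply Rmin_glb_lt|]. intros y Hy.
    assert (E1 := H1 y (fun i => Rlt_le_trans _ _ _ (Hy i) (Rmin_l _ _))).
    assert (E2 := H2 y (fun i => Rlt_le_trans _ _ _ (Hy i) (Rmin_r _ _))).
    apply Rabs_def2 in E1, E2. apply Rabs_def1; lra.
Qed.

Lemma list_max {A : Type} (f : A -> R) (x0 : A) (s : list A) :
  exists y, f x0 <= f y /\ forall z, In z s -> f z <= f y.
Proof.
  induction s as [|x s [y [Hy0 Hy]]].
  - exists x0. split; [lra|contradiction].
  - destruct (Rle_dec (f x) (f y)).
    + exists y. split; [exact Hy0|]. intros z [<-|Hz]; auto.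
    + exists x. split; [lra|]. intros z [<-|Hz]; [lra|]. specialize (Hy z Hz). lra.
Qed.

(** Without a maximizer the open sets [f x < f y], indexed by [y], would cover [K]; the largest
    value among [x0] and the indices of a finite subcover would then be a global maximum. *)
Lemma global_max_exists D (f : Param D -> R) (K : Param D -> Prop) x0 :
  cont f -> is_compact K -> (forall t, ~ K t -> f t <= f x0) -> exists x, is_global_max f x.
Proof.
  intros Hf HK Hout. apply NNPP. intros Hno.
  destruct (HK (Param D) (fun y x => f x < f y)) as [s Hs].
  - intros y x Hx. destruct (Hf x (f y - f x)) as [r [Hr Hxr]]; [lra|].
    exists r. split; [exact Hr|]. intros z Hz. specialize (Hxr z Hz).
    apply Rabs_def2 in Hxr. lra.
  - intros x _. apply NNPP. intros Hx. apply Hno. exists x. intros y.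
    apply Rnot_lt_le. intros Hlt. apply Hx. now exists y.
  - destruct (list_max f x0 s) as [y [Hy0 Hy]]. apply Hno. exists y. intros t.
    destruct (classic (K t)) as [Ht|Ht].
    + destruct (Hs t Ht) as [z [Hz Hlt]]. specialize (Hy z Hz). lra.
    + specialize (Hout t Ht). lra.
Qed.

(** * The span of the kernels of the support *)

Section Span.

Variables (D : nat) (H : RealHilbert) (a : Param D -> H) (k : nat) (th : nat -> Param D).

Definition kspan (c : nat -> R) (t : Param D) : R := sumR k (fun l => c l * kappa a t (th l)).

(** Coefficient vectors keep the full index range and vanish off [T], so that those over different
    subsets can be added directly. *)
Definition supported (T : nat -> bool) (c : nat -> R) : Prop :=
  forall l, (l < k)%nat -> T l = false -> c l = 0.

Definition in_support (T : nat -> bool) (t : Param D) : Prop :=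
  exists l, (l < k)%nat /\ T l = true /\ t = th l.

Lemma kspan_combine c d x y t :
  kspan (fun l => x * c l + y * d l) t = x * kspan c t + y * kspan d t.
Proof.
  unfold kspan. rewrite <- !sumR_scal, <- sumR_plus. apply sumR_ext. intros; ring.
Qed.

Lemma kspan_delta j t : (j < k)%nat -> kspan (delta j) t = kappa a t (th j).
Proof. intros Hj. now apply (sumR_delta k j (fun l => kappa a t (th l))). Qed.

Lemma supported_combine T c d x y :
  supported T c -> supported T d -> supported T (fun l => x * c l + y * d l).
Proof. intros Hc Hd l Hl HT. rewrite (Hc l Hl HT), (Hd l Hl HT). ring. Qed.

Lemma supported_delta T j : T j = true -> supported T (delta j).
Proof.
  intros Hj l _ Hl. apply delta_neq. intros ->. congruence.
Qed.

Lemma supported_mono (P T : nat -> bool) c :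
  (forall l, (l < k)%nat -> P l = true -> T l = true) -> supported P c -> supported T c.
Proof.
  intros HPT Hc l Hl HT. apply Hc; [exact Hl|].
  destruct (P l) eqn:E; [|reflexivity]. rewrite HPT in HT; congruence.
Qed.

Lemma sumR_supported T c (g : nat -> R) : supported T c ->
  sumR k (fun l => if T l then c l * g l else 0) = sumR k (fun l => c l * g l).
Proof.
  intros Hc. apply sumR_ext. intros l Hl.
  destruct (T l) eqn:E; [reflexivity|]. rewrite (Hc l Hl E). ring.
Qed.

Hypothesis Hker : kernel_admissible a.

Lemma kappa_sym t t' : kappa a t t' = kappa a t' t.
Proof. apply inner_sym. Qed.

(** Symmetry of the Gram matrix: both sides are its bilinear form at [c] and [d]. *)
Lemma kspan_dual c d :
  sumR k (fun l => c l * kspan d (th l)) = sumR k (fun l => d l * kspan c (th l)).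
Proof.
  unfold kspan.
  transitivity (sumR k (fun i => sumR k (fun j => c i * (d j * kappa a (th i) (th j))))).
  - apply sumR_ext. intros. now rewrite sumR_scal.
  - rewrite sumR_exchange. apply sumR_ext. intros j _. rewrite <- sumR_scal.
    apply sumR_ext. intros i _. rewrite (kappa_sym (th j)). ring.
Qed.

Lemma kappa_diag t : kappa a t t = 1.
Proof. apply Hker. Qed.

Lemma kappa_lt1 t t' : t <> t' -> kappa a t t' < 1.
Proof. intros Ht. now apply Hker. Qed.

Lemma kappa_ge0 t t' : 0 <= kappa a t t'.
Proof.
  destruct (classic (t = t')) as [<-|Ht]; [rewrite kappa_diag; lra|]. now apply Hker.
Qed.

(* Continuity off the diagonal: [|kappa(x,s) - kappa(y,s)|^2 <= |a x - a y|^2 = 2 - 2 kappa(x,y)]. *)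
Lemma kappa_cont s : cont (fun t => kappa a t s).
Proof.
  intros x eps Heps. destruct Hker as [_ [Hc _]].
  destruct (Hc x (eps * eps / 2)) as [r [Hr Hy]]; [nra|].
  exists r. split; [exact Hr|]. intros y Hxy.
  destruct (classic (y = x)) as [->|Hne]; [rewrite Rminus_diag, Rabs_R0; exact Heps|].
  specialize (Hy y Hne Hxy). apply Rabs_def2 in Hy.
  assert (Hsq := inner_unit_sqr_le H (vsub (a y) (a x)) (a s) (kappa_diag s)).
  rewrite !inner_sub_l, !inner_sub_r in Hsq.
  fold (kappa a y s) (kappa a x s) (kappa a y y) (kappa a x x) (kappa a x y) (kappa a y x) in Hsq.
  rewrite !kappa_diag, (kappa_sym y x) in Hsq.
  apply Rabs_def1; nra.
Qed.

Lemma kspan_cont c : cont (kspan c).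
Proof.
  apply (cont_sumR D k (fun l t => c l * kappa a t (th l))).
  intros l _. apply cont_scal, kappa_cont.
Qed.

Lemma kappa_vanish n eps : eps > 0 ->
  exists K, is_compact K /\ forall l t, (l < n)%nat -> ~ K t -> kappa a t (th l) < eps.
Proof.
  intros Heps. induction n as [|n [K [HK Hn]]].
  - exists (fun _ => False). split; [apply compact_empty|]. intros; lia.
  - destruct Hker as [_ [_ [Hv _]]].
    destruct (Hv eps (th n) Heps) as [L [HL [eta [Heta Hout]]]].
    exists (fun x => K x \/ L x). split; [now apply compact_union|].
    intros l t Hl Ht. destruct (Nat.eq_dec l n) as [->|Hln].
    + assert (kappa a t (th n) <= eta) by (apply Hout; tauto). lra.
    + apply Hn; [lia|tauto].
Qed.

(** The value at [th l0] is at least [c l0 > 0], whereas the combination is small outside a compact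
    set. *)
Lemma kspan_global_max c l0 :
  (forall l, (l < k)%nat -> 0 <= c l) -> (l0 < k)%nat -> 0 < c l0 ->
  exists x, is_global_max (kspan c) x.
Proof.
  intros Hc Hl0 Hpos.
  assert (Hs : c l0 <= kspan c (th l0)).
  { replace (c l0) with (c l0 * kappa a (th l0) (th l0)) by (rewrite kappa_diag; ring).
    apply (sumR_term_le k l0 (fun l => c l * kappa a (th l0) (th l))); [exact Hl0|].
    intros l Hl. apply Rmult_le_pos; [now apply Hc|apply kappa_ge0]. }
  assert (HC := sumR_nonneg k c Hc).
  destruct (kappa_vanish k (kspan c (th l0) / (1 + sumR k c))) as [K [HK Hout]].
  { apply Rdiv_lt_0_compat; lra. }
  apply (global_max_exists D (kspan c) K (th l0)); [apply kspan_cont|exact HK|].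
  intros t Ht.
  apply Rle_trans with (kspan c (th l0) / (1 + sumR k c) * sumR k c).
  - rewrite <- sumR_scal. apply sumR_le. intros l Hl.
    rewrite (Rmult_comm _ (c l)). apply Rmult_le_compat_l; [now apply Hc|].
    apply Rlt_le. now apply Hout.
  - apply Rmult_le_reg_r with (1 + sumR k c); [lra|].
    replace (kspan c (th l0) / (1 + sumR k c) * sumR k c * (1 + sumR k c))
      with (kspan c (th l0) * sumR k c) by (field; lra). nra.
Qed.

(** * Consequences of the admissibility of the support *)

Hypothesis Hinj :
  forall l l', (l < k)%nat -> (l' < k)%nat -> th l = th l' -> l = l'.
Hypothesis Hadm : support_admissible a k th.

Lemma not_in_support T n : (n < k)%nat -> T n = false -> ~ in_support T (th n).
Proof.
  intros Hn HT [l [Hl [HTl E]]]. apply Hinj in E; [congruence|exact Hn|exact Hl].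
Qed.

Lemma kappa_support_lt1 l l' : (l < k)%nat -> (l' < k)%nat -> l <> l' -> kappa a (th l) (th l') < 1.
Proof.
  intros Hl Hl' Hne. apply kappa_lt1. intros E. apply Hne. now apply Hinj.
Qed.

(** A global maximizer exists and lies in [T] by admissibility (i); if [t] reached the same value,
    it would be a maximizer too and lie in [T]. *)
Lemma positive_max_on_support T c :
  supported T c -> (forall l, (l < k)%nat -> T l = true -> 0 < c l) ->
  (exists l, (l < k)%nat /\ T l = true) ->
  forall t, ~ in_support T t ->
  exists l, (l < k)%nat /\ T l = true /\ kspan c t < kspan c (th l).
Proof.
  intros Hsup Hpos Hne t Ht.
  assert (Hc0 : forall l, (l < k)%nat -> 0 <= c l).
  { intros l Hl. destruct (T l) eqn:E; [apply Rlt_le; now apply Hpos|].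
    rewrite (Hsup l Hl E). lra. }
  assert (HC := sumR_nonneg k c Hc0).
  (* Scaling by [s] brings the total weight below 1, as admissibility demands, and keeps the
     maximizers. *)
  set (s := / (1 + sumR k c)).
  assert (Hs : 0 < s) by (apply Rinv_0_lt_compat; lra).
  destruct (Hadm T (fun l => s * c l) Hne) as [Hmax _].
  - intros l Hl HT. apply Rmult_lt_0_compat; [exact Hs|now apply Hpos].
  - rewrite (sumR_ext k _ (fun l => s * c l)), sumR_scal.
    + assert (s * (1 + sumR k c) = 1) by (unfold s; field; lra). lra.
    + intros l Hl. destruct (T l) eqn:E; [reflexivity|]. rewrite (Hsup l Hl E). ring.
  - assert (Hpsi : forall u, sumR k (fun l => if T l then s * c l * kappa a u (th l) else 0)
                             = s * kspan c u).
    { intros u. unfold kspan. rewrite <- sumR_scal. apply sumR_ext. intros l Hl.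
      destruct (T l) eqn:E; [ring|]. rewrite (Hsup l Hl E). ring. }
    assert (Hmax' : forall u, is_global_max (kspan c) u -> in_support T u).
    { intros u Hu. apply Hmax. intros v. rewrite !Hpsi.
      apply Rmult_le_compat_l; [lra|apply Hu]. }
    destruct Hne as [l0 [Hl0 HT0]].
    destruct (kspan_global_max c l0 Hc0 Hl0 (Hpos l0 Hl0 HT0)) as [x Hx].
    destruct (Hmax' x Hx) as [l [Hl [HTl ->]]].
    exists l. split; [exact Hl|]. split; [exact HTl|].
    apply Rnot_le_lt. intros Hle. apply Ht, Hmax'. intros v. specialize (Hx v). lra.
Qed.

(** Admissibility (ii) in terms of [kspan]; for empty [T] the combination is zero and the kernel is
    nonnegative. *)
Lemma positive_below_kernel T c n :
  supported T c -> (forall l, (l < k)%nat -> T l = true -> 0 < c l) ->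
  sumR k c < 1 -> (n < k)%nat -> T n = false ->
  (forall l, (l < k)%nat -> T l = true -> kspan c (th l) <= kappa a (th l) (th n)) ->
  forall t, kspan c t <= kappa a t (th n).
Proof.
  intros Hsup Hpos Hsum Hn HTn Hle t.
  destruct (classic (exists l, (l < k)%nat /\ T l = true)) as [Hne|He].
  - destruct (Hadm T c Hne Hpos) as [_ Hbelow].
    + erewrite sumR_ext; [exact Hsum|]. intros l Hl. cbv beta.
      destruct (T l) eqn:E; [reflexivity|]. now rewrite (Hsup l Hl E).
    + assert (Hb : kspan c t - kappa a t (th n) <= 0); [|lra].
      unfold kspan. rewrite <- (sumR_supported T c (fun l => kappa a t (th l)) Hsup).
      apply Hbelow; [exact Hn|exact HTn|]. intros l Hl HTl.
      rewrite (sumR_supported T c (fun j => kappa a (th l) (th j)) Hsup).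
      specialize (Hle l Hl HTl). unfold kspan in Hle. lra.
  - unfold kspan. rewrite sumR_0; [apply kappa_ge0|]. intros l Hl.
    destruct (T l) eqn:E; [exfalso; apply He; now exists l|]. rewrite (Hsup l Hl E). ring.
Qed.

(** * Recovery property of subsets of the support *)

(* For [M = 1] this is Tropp's exact recovery condition [|G^{-1} g(t)|_1 < 1]. *)
Definition exact_recovery_condition (T : nat -> bool) : Prop :=
  forall c M, supported T c -> 0 < M ->
    (forall l, (l < k)%nat -> T l = true -> Rabs (kspan c (th l)) <= M) ->
    forall t, ~ in_support T t -> kspan c t < M.

(** Surjectivity of the Gram matrix of [T]; linear independence of the atoms is later derived from
    it. *)
Definition interpolating (T : nat -> bool) : Prop :=
  forall v : nat -> R, exists c, supported T c /\
    forall l, (l < k)%nat -> T l = true -> kspan c (th l) = v l.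

(** Quantifying over all interpolating [c] avoids any appeal to their uniqueness. *)
Definition interpolants_below (T : nat -> bool) : Prop :=
  forall n c, (n < k)%nat -> T n = false -> supported T c ->
    (forall l, (l < k)%nat -> T l = true -> kspan c (th l) = kappa a (th l) (th n)) ->
    forall t, kspan c t <= kappa a t (th n).

(** Proved jointly, since the step for each property uses others on smaller subsets. *)
Definition recoverable (T : nat -> bool) : Prop :=
  exact_recovery_condition T /\ interpolating T /\ interpolants_below T.

(** An interpolant on [P] lies below its kernel, so under a nonpositive coefficient the replacement
    can only raise the combination. *)
Lemma reduce_support P c :
  interpolating P -> interpolants_below P ->
  (forall l, (l < k)%nat -> P l = false -> c l <= 0) ->
  exists h, supported P h /\
    (forall l, (l < k)%nat -> P l = true -> kspan h (th l) = kspan c (th l)) /\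
    forall t, kspan c t <= kspan h t.
Proof.
  intros HI HN Hc.
  enough (Hm : forall m, (m <= k)%nat -> exists h, supported P h /\
    (forall l, (l < k)%nat -> P l = true ->
       kspan h (th l) = sumR m (fun j => c j * kappa a (th l) (th j))) /\
    forall t, sumR m (fun j => c j * kappa a t (th j)) <= kspan h t)
    by exact (Hm k (le_n k)).
  induction m as [|m IH]; intros Hm.
  - assert (Hz : forall t, kspan (fun _ => 0) t = 0).
    { intros t. apply sumR_0. intros; ring. }
    exists (fun _ => 0). split; [now intros l _ _|].
    split; intros; rewrite Hz; simpl; lra.
  - destruct IH as [h [Hh [Heq Hle]]]; [lia|]. simpl. destruct (P m) eqn:HPm.
    + exists (fun l => 1 * h l + c m * delta m l).
      split; [now apply supported_combine, supported_delta|].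
      assert (E : forall t, kspan (fun l => 1 * h l + c m * delta m l) t
                            = kspan h t + c m * kappa a t (th m)).
      { intros t. rewrite kspan_combine, kspan_delta by lia. ring. }
      split; [intros l Hl HP; now rewrite E, Heq|].
      intros t. rewrite E. specialize (Hle t). lra.
    + destruct (HI (fun l => kappa a (th l) (th m))) as [p [Hp Hpeq]].
      assert (Hple := HN m p Hm HPm Hp Hpeq).
      exists (fun l => 1 * h l + c m * p l). split; [now apply supported_combine|]. split.
      * intros l Hl HP. rewrite kspan_combine, Heq, Hpeq by assumption. ring.
      * intros t. rewrite kspan_combine. specialize (Hle t). specialize (Hple t).
        specialize (Hc m Hm HPm). nra.
Qed.

Definition positive_part (c : nat -> R) (l : nat) : bool := if Rlt_dec 0 (c l) then true else false.

Lemma positive_part_true c l : positive_part c l = true <-> 0 < c l.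
Proof. unfold positive_part. destruct (Rlt_dec 0 (c l)); split; (easy || lra). Qed.

Lemma positive_part_false c l : positive_part c l = false <-> c l <= 0.
Proof. unfold positive_part. destruct (Rlt_dec 0 (c l)); split; (easy || lra). Qed.

Lemma positive_part_sub T c l :
  supported T c -> (l < k)%nat -> positive_part c l = true -> T l = true.
Proof.
  intros Hc Hl HP. apply positive_part_true in HP.
  destruct (T l) eqn:E; [reflexivity|]. rewrite (Hc l Hl E) in HP. lra.
Qed.

Lemma in_support_mono (P T : nat -> bool) t :
  (forall l, (l < k)%nat -> P l = true -> T l = true) -> in_support P t -> in_support T t.
Proof. intros HPT [l [Hl [HP Ht]]]. exists l. auto. Qed.

(** * Induction step on the cardinality of [T] *)

Section InductionStep.

Variable T : nat -> bool.
Hypothesis IH : forall P, (cardn k P < cardn k T)%nat -> recoverable P.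

Lemma erc_step : exact_recovery_condition T.
Proof.
  intros c M Hc HM Hb t Ht. set (P := positive_part c).
  assert (HPT : forall l, (l < k)%nat -> P l = true -> T l = true).
  { intros l. now apply positive_part_sub. }
  destruct (classic (exists l, (l < k)%nat /\ T l = true /\ P l = false))
    as [[l0 [Hl0 [HT0 HP0]]]|Hall].
  (* A nonpositive coefficient on [T] makes [P] strictly smaller, and the bound [M] passes to the
     dominating [h] over [P]. *)
  - destruct (IH P (cardn_strict k P T l0 HPT Hl0 HT0 HP0)) as [HE [HI HN]].
    destruct (reduce_support P c HI HN) as [h [Hh [Heq Hle]]].
    { intros l _ Hl. now apply positive_part_false. }
    apply Rle_lt_trans with (1 := Hle t). apply (HE h M Hh HM).
    + intros l Hl HP. rewrite Heq by assumption. auto.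
    + intros HP. now apply Ht, (in_support_mono P).
  - assert (Hpos : forall l, (l < k)%nat -> T l = true -> 0 < c l).
    { intros l Hl HT. apply Rnot_le_lt. intros Hle. apply Hall. exists l.
      repeat split; auto. now apply positive_part_false. }
    destruct (classic (exists l, (l < k)%nat /\ T l = true)) as [Hne|He].
    + destruct (positive_max_on_support T c Hc Hpos Hne t Ht) as [l [Hl [HT Hlt]]].
      specialize (Hb l Hl HT). assert (Hn := Rle_abs (kspan c (th l))). lra.
    + unfold kspan. rewrite sumR_0; [exact HM|]. intros l Hl.
      destruct (T l) eqn:E; [exfalso; apply He; now exists l|]. rewrite (Hc l Hl E). ring.
Qed.

(** Bordering by one index [l0]: the kernel at [l0] minus its interpolant on the remaining indices
    [Q] vanishes on [Q] and is positive at [th l0], so a multiple of it corrects the value there. *)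
Lemma interpolating_step : interpolating T.
Proof.
  intros v. destruct (classic (exists l, (l < k)%nat /\ T l = true)) as [[l0 [Hl0 HT0]]|He].
  2:{ exists (fun _ => 0). split; [now intros l _ _|].
      intros l Hl HT. exfalso. apply He. now exists l. }
  set (Q := fun l => T l && negb (Nat.eqb l l0)).
  assert (HQT : forall l, (l < k)%nat -> Q l = true -> T l = true).
  { intros l _ HQ. now apply andb_true_iff in HQ. }
  assert (HQ0 : Q l0 = false) by (unfold Q; now rewrite Nat.eqb_refl, andb_false_r).
  assert (HQneq : forall l, Q l = true -> l <> l0) by (intros l HQ ->; congruence).
  destruct (IH Q (cardn_strict k Q T l0 HQT Hl0 HT0 HQ0)) as [HE [HI _]].
  destruct (HI v) as [h [Hh Hhv]].
  destruct (HI (fun l => kappa a (th l) (th l0))) as [p [Hp Hpv]].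
  (* On [Q] the interpolant equals a kernel with values in [0, 1), so the recovery condition with
     [M = 1] applies. *)
  assert (Hlt : kspan p (th l0) < 1).
  { apply (HE p 1 Hp); [lra| |now apply not_in_support].
    intros l Hl HQ. rewrite Hpv by assumption. assert (Hk := kappa_ge0 (th l) (th l0)).
    rewrite Rabs_pos_eq by exact Hk. apply Rlt_le, kappa_support_lt1; auto. }
  set (s := (v l0 - kspan h (th l0)) / (1 - kspan p (th l0))).
  exists (fun l => 1 * h l + s * (1 * delta l0 l + (-1) * p l)). split.
  - assert (Hm := fun c => supported_mono Q T c HQT).
    auto using supported_combine, supported_delta.
  - intros l Hl HT.
    rewrite (kspan_combine h (fun l => 1 * delta l0 l + (-1) * p l)), kspan_combine, kspan_delta
      by exact Hl0.
    destruct (Nat.eq_dec l l0) as [->|Hne].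
    + rewrite kappa_diag. unfold s. field. lra.
    + assert (HQ : Q l = true).
      { unfold Q. apply Nat.eqb_neq in Hne as ->. now rewrite HT. }
      rewrite Hhv, Hpv by assumption. ring.
Qed.

(** If [c b < 0], replacing the kernel at [b] by its interpolant [p] on the positive indices [A]
    strictly raises the combination at [th b], since [kspan p (th b) < 1]. Reducing the other
    nonpositive terms too gives an interpolant on [A] of the kernel at [n] that exceeds this kernel
    at [th b], a contradiction. *)
Lemma interpolant_coef_nonneg n c :
  (n < k)%nat -> T n = false -> supported T c ->
  (forall l, (l < k)%nat -> T l = true -> kspan c (th l) = kappa a (th l) (th n)) ->
  forall b, (b < k)%nat -> 0 <= c b.
Proof.
  intros Hn HTn Hc Heq b Hb. apply Rnot_lt_le. intros Hneg.
  set (A := positive_part c).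
  assert (HAT : forall l, (l < k)%nat -> A l = true -> T l = true).
  { intros l. now apply positive_part_sub. }
  assert (HTb : T b = true).
  { destruct (T b) eqn:E; [reflexivity|]. rewrite (Hc b Hb E) in Hneg. lra. }
  assert (HAb : A b = false) by (apply positive_part_false; lra).
  assert (HAn : A n = false) by (apply positive_part_false; rewrite (Hc n Hn HTn); lra).
  destruct (IH A (cardn_strict k A T b HAT Hb HTb HAb)) as [HE [HI HN]].
  destruct (HI (fun l => kappa a (th l) (th b))) as [p [Hp Hpv]].
  assert (Hplt : kspan p (th b) < 1).
  { apply (HE p 1 Hp); [lra| |now apply not_in_support].
    intros l Hl HA. rewrite Hpv by assumption. rewrite Rabs_pos_eq by apply kappa_ge0.
    apply Rlt_le, kappa_support_lt1; auto. intros ->. congruence. }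
  destruct (reduce_support A (fun l => 1 * c l + (- c b) * delta b l) HI HN)
    as [h [Hh [Hheq Hhle]]].
  { intros l _ HA. apply positive_part_false in HA. destruct (Nat.eq_dec b l) as [<-|Hne].
    - rewrite delta_same. lra.
    - rewrite delta_neq by exact Hne. lra. }
  assert (Hle := HN n (fun l => 1 * h l + c b * p l) Hn HAn (supported_combine A h p 1 (c b) Hh Hp)).
  assert (Hval : kspan (fun l => 1 * h l + c b * p l) (th b) <= kappa a (th b) (th n)).
  { apply Hle. intros l Hl HA.
    rewrite kspan_combine, Hheq, Hpv, kspan_combine, kspan_delta by assumption.
    rewrite <- (Heq l) by auto. ring. }
  rewrite kspan_combine in Hval. specialize (Hhle (th b)).
  rewrite kspan_combine, kspan_delta, kappa_diag in Hhle by exact Hb.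
  rewrite <- Heq in Hval by assumption. nra.
Qed.

(** Zero coefficients are dropped by passing to [A], where all are positive and admissibility (ii)
    applies once the total weight is below 1. *)
Lemma interpolants_below_step : interpolants_below T.
Proof.
  intros n c Hn HTn Hc Heq.
  assert (Hc0 := interpolant_coef_nonneg n c Hn HTn Hc Heq).
  set (A := positive_part c).
  assert (HAT : forall l, (l < k)%nat -> A l = true -> T l = true).
  { intros l. now apply positive_part_sub. }
  apply (positive_below_kernel A).
  - intros l Hl HA. apply positive_part_false in HA. specialize (Hc0 l Hl). lra.
  - intros l _. apply positive_part_true.
  - (* With [d] interpolating [1] on [T]: [sum c = <c, d> = kspan d (th n) < 1]. *)
    destruct (interpolating_step (fun _ => 1)) as [d [Hd Hd1]].
    assert (Hlt : kspan d (th n) < 1).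
    { apply (erc_step d 1 Hd); [lra| |now apply not_in_support].
      intros l Hl HT. rewrite Hd1 by assumption. rewrite Rabs_R1. lra. }
    replace (sumR k c) with (kspan d (th n)); [exact Hlt|].
    transitivity (sumR k (fun l => d l * kspan c (th l))).
    + apply sumR_ext. intros l Hl. destruct (T l) eqn:E.
      * rewrite Heq by assumption. now rewrite kappa_sym.
      * rewrite (Hd l Hl E). ring.
    + rewrite kspan_dual. apply sumR_ext. intros l Hl. destruct (T l) eqn:E.
      * rewrite Hd1 by assumption. ring.
      * rewrite (Hc l Hl E). ring.
  - exact Hn.
  - apply positive_part_false. rewrite (Hc n Hn HTn). lra.
  - intros l Hl HA. apply Req_le. auto.
Qed.

End InductionStep.

(** * Consequences for all subsets of the support *)

Lemma all_recoverable T : recoverable T.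
Proof.
  induction T as [T IH] using (well_founded_induction (well_founded_ltof _ (cardn k))).
  assert (IH' : forall P, (cardn k P < cardn k T)%nat -> recoverable P) by exact IH.
  split; [|split].
  - now apply erc_step.
  - now apply interpolating_step.
  - now apply interpolants_below_step.
Qed.

(** Pairing [d] with the interpolant [e] of the unit vector at [l] extracts [d l]; by symmetry this
    pairing is a combination of values of [kspan d], which vanish. *)
Lemma kspan_independent T d :
  supported T d -> (forall t, kspan d t = 0) -> forall l, (l < k)%nat -> T l = true -> d l = 0.
Proof.
  intros Hd Hz l Hl HT.
  destruct (all_recoverable T) as [_ [HI _]]. destruct (HI (delta l)) as [e [He Hev]].
  transitivity (sumR k (fun j => delta l j * d j)); [now rewrite sumR_delta|].
  transitivity (sumR k (fun j => d j * kspan e (th j))).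
  - apply sumR_ext. intros j Hj. destruct (T j) eqn:E.
    + rewrite Hev by assumption. ring.
    + rewrite (Hd j Hj E). ring.
  - rewrite kspan_dual. apply sumR_0. intros j _. rewrite Hz. ring.
Qed.

(** If [t] were off [T], the recovery condition with [M] the modulus at [t], applied to [c] and to
    its opposite, would make that modulus smaller than itself. *)
Lemma abs_maximizer_in_support T c t :
  supported T c -> (exists u, kspan c u <> 0) ->
  (forall u, Rabs (kspan c u) <= Rabs (kspan c t)) -> in_support T t.
Proof.
  intros Hc [u Hu] Hmax. apply NNPP. intros Ht.
  destruct (all_recoverable T) as [HE _].
  assert (HM : 0 < Rabs (kspan c t)) by (apply Rlt_le_trans with (2 := Hmax u); now apply Rabs_pos_lt).
  assert (H1 := HE c _ Hc HM (fun l _ _ => Hmax (th l)) t Ht).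
  assert (Hneg : forall s, kspan (fun l => -1 * c l + 0 * c l) s = - kspan c s).
  { intros s. rewrite kspan_combine. ring. }
  assert (H2 : kspan (fun l => -1 * c l + 0 * c l) t < Rabs (kspan c t)).
  { apply (HE _ _ (supported_combine T c c (-1) 0 Hc Hc) HM); [|exact Ht].
    intros l _ _. rewrite Hneg, Rabs_Ropp. apply Hmax. }
  rewrite Hneg in H2.
  destruct (Rcase_abs (kspan c t)) as [Hs|Hs];
    [rewrite Rabs_left in * by exact Hs|rewrite Rabs_right in * by exact Hs]; lra.
Qed.

(** * Orthogonal matching pursuit *)

(* [v] and [sum_l c_l a(theta_l)] have the same inner products, i.e. are equal. *)
Definition represents (c : nat -> R) (v : H) : Prop :=
  forall x, inner x v = sumR k (fun l => c l * inner x (a (th l))).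

Lemma represents_inner c v t : represents c v -> inner (a t) v = kspan c t.
Proof. intros Hv. apply Hv. Qed.

Lemma represents_vsum (T : nat -> bool) c :
  represents (fun l => if T l then c l else 0)
    (vsum k (fun l => if T l then vscal (c l) (a (th l)) else vzero)).
Proof.
  clear Hinj Hadm. intros x. induction k as [|m IH]; simpl; [apply inner_zero_r|].
  rewrite inner_add_r, IH. destruct (T m); [now rewrite inner_scal_r|].
  rewrite inner_zero_r. ring.
Qed.

Lemma represents_sub c d u v :
  represents c u -> represents d v -> represents (fun l => 1 * c l + (-1) * d l) (vsub u v).
Proof.
  intros Hu Hv x. rewrite inner_sub_r, Hu, Hv.
  rewrite (sumR_ext k (fun l => (1 * c l + -1 * d l) * _)
             (fun l => c l * inner x (a (th l)) + (-1) * (d l * inner x (a (th l)))))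
    by (intros; ring).
  rewrite sumR_plus, sumR_scal. ring.
Qed.

(** The squared norm of [v] is the sum of the [c l * kspan c (th l)], so a nonzero [v] forces a
    nonzero value at a support point. *)
Lemma represents_nonzero c v : represents c v -> v <> vzero -> exists t, kspan c t <> 0.
Proof.
  intros Hv Hne. apply NNPP. intros Hno. apply Hne, inner_def. rewrite (Hv v).
  apply sumR_0. intros l _. rewrite inner_sym, (represents_inner c v (th l) Hv).
  replace (kspan c (th l)) with 0; [ring|].
  apply NNPP. intros E. apply Hno. exists (th l). auto.
Qed.

(** A point may occur several times in [ths], and its coefficients then add up; the last clause
    serves to detect points never selected. *)
Lemma represents_comb T ths (c : nat -> R) :
  (forall t, In t ths -> in_support T t) ->
  exists d, represents d (comb a ths c) /\ supported T d /\
    forall l, (l < k)%nat -> ~ In (th l) ths -> d l = 0.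
Proof.
  revert c. induction ths as [|t ths IH]; intros c Hths.
  - exists (fun _ => 0). split; [|split; now intros].
    intros x. simpl. rewrite inner_zero_r, sumR_0; [reflexivity|]. intros; ring.
  - destruct (IH (fun n => c (S n)) (fun u Hu => Hths u (or_intror Hu))) as [d [Hd [Hs Hz]]].
    destruct (Hths t (or_introl eq_refl)) as [j [Hj [HTj ->]]].
    exists (fun l => 1 * d l + c O * delta j l). split; [|split].
    + intros x. simpl. rewrite inner_add_r, inner_scal_r, Hd.
      rewrite <- (sumR_delta k j (fun l => inner x (a (th l)))) by exact Hj.
      rewrite <- sumR_scal, <- sumR_plus. apply sumR_ext. intros; ring.
    + apply supported_combine; [exact Hs|now apply supported_delta].
    + intros l Hl Hin. simpl in Hin. rewrite Hz by tauto.
      rewrite delta_neq; [ring|]. intros ->. tauto.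
Qed.

Lemma omp_run_residual y ths r :
  omp_run a y ths r -> exists c, r = vsub y (comb a ths c).
Proof.
  intros [|ths' r0 t r' _ _ _ [c [_ ->]]]; [|now exists c].
  exists (fun _ => 0). unfold vsub. simpl. rewrite <- (vadd_0l H (vopp vzero)), vadd_oppr.
  now rewrite vadd_comm, vadd_0l.
Qed.

(** Inductively, earlier selections lie in [T], so the current residual is a nonzero span element
    over [T] and the next maximizer of its modulus lies in [T]. *)
Lemma omp_run_in_support T c0 y ths r :
  represents c0 y -> supported T c0 -> omp_run a y ths r ->
  forall t, In t ths -> in_support T t.
Proof.
  intros Hy Hs Hrun. induction Hrun as [|ths r t r' Hrun IH Hr Hmax _]; [contradiction|].
  intros u Hu. apply in_app_or in Hu as [Hu|[<-|[]]]; [now apply IH|].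
  destruct (omp_run_residual y ths r Hrun) as [c ->].
  destruct (represents_comb T ths c IH) as [d [Hd [Hds _]]].
  assert (Hrep := represents_sub c0 d _ _ Hy Hd).
  apply (abs_maximizer_in_support T _ t (supported_combine T c0 d 1 (-1) Hs Hds)).
  - exact (represents_nonzero _ _ Hrep Hr).
  - intros u. rewrite <- !(represents_inner _ _ _ Hrep). apply Hmax.
Qed.

(** Selections lie in [T] by [omp_run_in_support]. Conversely, a zero residual forces its
    coefficients to vanish by independence; at an unselected [l] in [T] this coefficient is [c l],
    which is nonzero. *)
Lemma exact_recovery_subset T : exact_recovery a k th T.
Proof.
  intros c Hc y S [ths [Hrun HS]] t. rewrite HS.
  assert (Hy : represents (fun l => if T l then c l else 0) y) by apply represents_vsum.
  assert (Hs : supported T (fun l => if T l then c l else 0)) by (intros l _ ->; reflexivity).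
  assert (Hin := omp_run_in_support T _ y ths vzero Hy Hs Hrun).
  split; [apply Hin|]. intros [l [Hl [HT ->]]]. apply NNPP. intros Hout.
  destruct (omp_run_residual y ths vzero Hrun) as [e He].
  destruct (represents_comb T ths e Hin) as [d [Hd [Hds Hdz]]].
  assert (Hrep := represents_sub _ d _ _ Hy Hd). rewrite <- He in Hrep.
  apply (Hc l Hl HT).
  assert (E : 1 * (if T l then c l else 0) + -1 * d l = 0).
  { apply (kspan_independent T (fun l => 1 * (if T l then c l else 0) + -1 * d l)); auto.
    - now apply supported_combine.
    - intros u. rewrite <- (represents_inner _ _ u Hrep). apply inner_zero_r. }
  rewrite HT, (Hdz l Hl Hout) in E. lra.
Qed.

End Span.

Theorem theorem2 (D : nat) (H : RealHilbert) (a : Param D -> H)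
    (k : nat) (th : nat -> Param D) :
  kernel_admissible a ->
  (forall l l', (l < k)%nat -> (l' < k)%nat -> th l = th l' -> l = l') ->
  support_admissible a k th ->
  forall T : nat -> bool, exact_recovery a k th T.
Proof.
  intros Hker Hinj Hadm T. now apply exact_recovery_subset.
Qed.
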